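(* Let $Q^{(1)},\dots,Q^{(n)}\in\mathbb{T}_\pm^{m\times m}$ be symmetric tropical matrices. Then the set $\mathcal{S}(Q^{(1)},\dots,Q^{(n)})\subset\mathbb{T}^n$ is a projection of a tropical Metzler spectrahedron; that is, there exist integers $N\ge n$ and $p\geq 1$ and symmetric tropical Metzler matrices $R^{(1)},\dots,R^{(N)}\in\mathbb{T}_\pm^{p\times p}$ such that $$\mathcal{S}(Q^{(1)},\dots,Q^{(n)})=\{x\in\mathbb{T}^n : \exists\, y\in\mathbb{T}^{N-n},\ (x,y)\in\mathcal{S}(R^{(1)},\dots,R^{(N)})\}.$$
   Context: $[m]=\{1,\dots,m\}$. $\mathbb{T}=\mathbb{R}\cup\{-\infty\}$ with the usual order and the usual conventions for $+$ and $\max$. The set $\mathbb{T}_\pm$ of signed tropical numbers is the disjoint union of $\mathbb{T}_+=\mathbb{R}$ (positive elements, written $a$), $\mathbb{T}_-=\{\ominus a: a\in\mathbb{R}\}$ (a formal second copy of $\mathbb{R}$, negative elements), and $\{-\infty\}$. The modulus is $|a|=|\ominus a|=a$ for $a\in\mathbb{R}$ and $|-\infty|=-\infty$. For symmetric matrices $Q^{(1)},\dots,Q^{(n)}\in\mathbb{T}_\pm^{m\times m}$, $x\in\mathbb{T}^n$ and $i,j\in[m]$ put $$Q_{ij}^{+}(x)=\max_{k:\,Q_{ij}^{(k)}\in\mathbb{T}_+}(|Q_{ij}^{(k)}|+x_k),\qquad Q_{ij}^{-}(x)=\max_{k:\,Q_{ij}^{(k)}\in\mathbb{T}_-}(|Q_{ij}^{(k)}|+x_k),$$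 with the maximum over the empty set equal to $-\infty$. The set $\mathcal{S}(Q^{(1)},\dots,Q^{(n)})$ consists of all $x\in\mathbb{T}^n$ such that: (1) $Q_{ii}^+(x)\ge Q_{ii}^-(x)$ for all $i\in[m]$; (2) for all $i<j$ in $[m]$, either $Q_{ii}^+(x)+Q_{jj}^+(x)\ge 2\max(Q_{ij}^+(x),Q_{ij}^-(x))$ or $Q_{ij}^+(x)=Q_{ij}^-(x)$. A matrix $M\in\mathbb{T}_\pm^{m\times m}$ is tropical Metzler if $M_{ij}\in\mathbb{T}_-\cup\{-\infty\}$ for all $i\neq j$. If all the matrices are symmetric tropical Metzler, then $\mathcal{S}(Q^{(1)},\dots,Q^{(n)})$ is called a tropical Metzler spectrahedron. *)

(* Defs.v *)
From mathcomp Require Import all_boot all_order all_algebra.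
From mathcomp Require Import boolp classical_sets reals ereal.

Set Implicit Arguments.
Unset Strict Implicit.
Unset Printing Implicit Defensive.

Import Order.TTheory GRing.Theory Num.Theory.

Local Open Scope classical_set_scope.
Local Open Scope ring_scope.
Local Open Scope ereal_scope.

(* T is carved out of the extended reals, so that its order, maximum and
   addition are those of [\bar R]; in particular [-oo + a = -oo]. *)
Definition tropical (R : realType) : Type := {a : \bar R | a != +oo}.

Inductive signed_tropical (R : realType) : Type :=
| STpos of R
| STneg of R
| STninfty.

Arguments STninfty {R}.

Section SignedTropical.
Variable R : realType.
Implicit Types a : signed_tropical R.

Definition is_STpos a : bool := if a is STpos _ then true else false.
Definition is_STneg a : bool := if a is STneg _ then true else false.

Definition modulus a : \bar R :=
  match a with
  | STpos r => r%:E
  | STneg r => r%:E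
  | STninfty => -oo
  end.

Definition sym_mx m (A : 'M[signed_tropical R]_m) : Prop := A^T%R = A.

Definition tropical_metzler m (A : 'M[signed_tropical R]_m) : Prop :=
  forall i j : 'I_m, i != j -> is_STneg (A i j) \/ A i j = STninfty.

Section Spectrahedron.
Variables (m n : nat) (Q : 'I_n -> 'M[signed_tropical R]_m).

Definition Qpos (x : 'rV[tropical R]_n) (i j : 'I_m) : \bar R :=
  \big[maxe/-oo]_(k < n | is_STpos (Q k i j))
    (modulus (Q k i j) + val (x ord0 k)).

Definition Qneg (x : 'rV[tropical R]_n) (i j : 'I_m) : \bar R :=
  \big[maxe/-oo]_(k < n | is_STneg (Q k i j))
    (modulus (Q k i j) + val (x ord0 k)).

Definition spectrahedron : set 'rV[tropical R]_n :=
  [set x |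
    (forall i : 'I_m, Qneg x i i <= Qpos x i i) /\
    (forall i j : 'I_m, (i < j)%N ->
       2%:E * maxe (Qpos x i j) (Qneg x i j) <= Qpos x i i + Qpos x j j
       \/ Qpos x i j = Qneg x i j)].

(* [Qpos] and [Qneg] are values of T, although typed in [\bar R]. *)
Lemma Qpos_neq_pinfty x i j : Qpos x i j != +oo.
Proof.
rewrite /Qpos; elim/big_ind: _ => //.
  by move=> a b aoo boo; rewrite /Order.max; case: ifP.
by move=> k; case: (Q k i j) => //= r _; case: (x ord0 k) => -[].
Qed.

Lemma Qneg_neq_pinfty x i j : Qneg x i j != +oo.
Proof.
rewrite /Qneg; elim/big_ind: _ => //.
  by move=> a b aoo boo; rewrite /Order.max; case: ifP.
by move=> k; case: (Q k i j) => //= r _; case: (x ord0 k) => -[].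
Qed.

End Spectrahedron.
End SignedTropical.

(* Main.v *)
Require Import Defs.
From mathcomp Require Import all_boot all_order all_algebra.
From mathcomp Require Import boolp classical_sets reals ereal.

Set Implicit Arguments.
Unset Strict Implicit.
Unset Printing Implicit Defensive.

Import Order.TTheory GRing.Theory Num.Theory.

Local Open Scope classical_set_scope.

(** With p = Q_ij^+(x), q = Q_ij^-(x), u = Q_ii^+(x) and v = Q_jj^+(x), the
    disjunction "u + v >= 2 max(p, q) or p = q" holds iff there is z in T with
    2 z <= u + v, p <= max(q, z) and q <= max(p, z): take z = -oo if p = q and
    z = max(p, q) otherwise; conversely, p <> q forces z >= max(p, q).
    The first inequality is a 2x2 minor with Metzler off-diagonal entry
    "minus z", and the other two are diagonal conditions. *)

(** * Tropical linear forms with signed coefficients, and the Metzler conditions *)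

Section TropicalForms.
Variable R : realType.
Local Notation ST := (signed_tropical R).
Local Open Scope ereal_scope.

Lemma slack_sound (p q w z : \bar R) :
  2%:E * z <= w -> p <= maxe q z -> q <= maxe p z ->
  2%:E * maxe p q <= w \/ p = q.
Proof.
move=> zw pqz qpz; have [->|npq] := eqVneq p q; first by right.
left; apply: le_trans zw; rewrite lee_pmul2l ?fin_numE// ?lte_fin// ge_max.
move: pqz qpz; rewrite !le_max.
(* The strictly larger of [p] and [q] cannot be bounded by the other one, so its hypothesis bounds
   it by [z]. *)
case: (ltgtP p q) npq => //= pq _; rewrite ?(ltW pq) ?orbT /=.
- by move=> _ qz; rewrite qz andbT (le_trans (ltW pq)).
- by move=> pz _; rewrite pz /= (le_trans (ltW pq)).
Qed.

(** With [c k = Q k i j], this is [Qpos Q x i j] for [s = is_STpos] and [Qneg Q x i j] for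
    [s = is_STneg]. A matrix entry of the lift can thus be given as a vector of coefficients. *)
Definition form n (s : pred ST) (c : 'I_n -> ST) (x : 'rV[tropical R]_n) :=
  \big[maxe/-oo]_(k < n | s (c k)) (modulus (c k) + val (x ord0 k)).

Definition concat n d (c : 'I_n -> ST) (c' : 'I_d -> ST) (k : 'I_(n + d)) :=
  match split k with inl i => c i | inr e => c' e end.

Definition zero_form n (_ : 'I_n) : ST := STninfty.

Definition var (T : finType) (t : T) (a : ST) (e : 'I_#|T|) : ST :=
  if e == enum_rank t then a else STninfty.

(** Tropical negation: it exchanges the positive and negative parts of a form, so that a diagonal
    condition can express the reverse inequality. *)
Definition flip (a : ST) : ST :=
  match a with STpos r => STneg r | STneg r => STpos r | STninfty => STninfty end.

Lemma form_concat n d (s : pred ST) (c : 'I_n -> ST) (c' : 'I_d -> ST) x y :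
  form s (concat c c') (row_mx x y) = maxe (form s c x) (form s c' y).
Proof.
rewrite /form big_split_ord /concat; congr maxe.
- by apply: eq_big => i; rewrite (unsplitK (inl i)) ?row_mxEl.
- by apply: eq_big => i; rewrite (unsplitK (inr i)) ?row_mxEr.
Qed.

Lemma form_zero n (s : pred ST) (x : 'rV_n) :
  s STninfty = false -> form s (@zero_form n) x = -oo.
Proof. by move=> s0; apply: big_pred0 => k; rewrite /zero_form s0. Qed.

Lemma form_var (T : finType) (t : T) s a y : s STninfty = false ->
  form s (var t a) y =
  if s a then modulus a + val (y ord0 (enum_rank t)) else -oo.
Proof.
move=> s0; rewrite /form /var; case: ifP => sa.
  rewrite (big_pred1 (enum_rank t)) => [|e]; first by rewrite eqxx.
  by rewrite /=; case: eqP.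
by apply: big_pred0 => e; case: ifP.
Qed.

Lemma form_flip_pos n (c : 'I_n -> ST) x :
  form (@is_STpos R) (fun k => flip (c k)) x = form (@is_STneg R) c x.
Proof. by apply: eq_big => k; case: (c k). Qed.

Lemma form_flip_neg n (c : 'I_n -> ST) x :
  form (@is_STneg R) (fun k => flip (c k)) x = form (@is_STpos R) c x.
Proof. by apply: eq_big => k; case: (c k). Qed.

(** Off the diagonal [Qpos] is a maximum over the empty set. The alternative [Qpos = Qneg] then
    means that [Qneg] is -oo, in which case the minor inequality holds anyway. Symmetry extends it
    from [i < j] to [i != j]. *)
Lemma metzler_spectrahedronP m n (P : 'I_n -> 'M[ST]_m) x :
  (forall k, sym_mx (P k)) -> (forall k, tropical_metzler (P k)) ->
  spectrahedron P x <->
  (forall i, Qneg P x i i <= Qpos P x i i) /\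
  (forall i j, i != j -> 2%:E * Qneg P x i j <= Qpos P x i i + Qpos P x j j).
Proof.
move=> symP metzP.
have Qpos_off i j : i != j -> Qpos P x i j = -oo.
  move=> ij; apply: big_pred0 => k.
  by case: (metzP k i j ij) => [|->//]; case: (P k i j).
have Qneg_sym i j : Qneg P x i j = Qneg P x j i.
  have PC k : P k j i = P k i j by rewrite -[in LHS]symP mxE.
  by apply: eq_big => k; rewrite PC.
split=> -[diag off]; split=> // i j ij.
  wlog lt_ij : i j ij / (i < j)%N => [H|].
    case: (ltngtP i j) => [|ji|/val_inj e]; first exact: H.
      by rewrite Qneg_sym addeC; apply: H; rewrite // eq_sym.
    by rewrite e eqxx in ij.
  case: (off i j lt_ij); rewrite Qpos_off// ?maxNye// => <-.
  by rewrite gt0_muleNy ?lte_fin// leNye.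
have {}ij : i != j by rewrite -(inj_eq val_inj) ltn_eqF.
by left; rewrite Qpos_off// maxNye; apply: off.
Qed.

End TropicalForms.

(** * The lifted Metzler matrices and their projection *)

Section MetzlerLift.
Variables (R : realType) (m n : nat) (Q : 'I_n -> 'M[signed_tropical R]_m).
Local Notation ST := (signed_tropical R).
Local Notation pair := ('I_m * 'I_m)%type.
Local Notation d := #|{: pair}|.
(* The index [None] only serves to make the size nonzero when [m = 0]. *)
Local Notation index := (option ('I_m + bool * pair)).
Local Open Scope ereal_scope.

(** Sends (i, j) and (j, i) to the same auxiliary variable, which keeps the lift symmetric. *)
Definition edge (i j : 'I_m) : pair := if (i < j)%N then (i, j) else (j, i).

Lemma edgeC i j : edge i j = edge j i.
Proof. by rewrite /edge; case: ltngtP => // /val_inj ->. Qed.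

(** Block diagonal. The [inl] block has the diagonal of [Q] and off-diagonal entries minus z; its
    minors give 2 z <= u + v. Each [inr (b, t)] is a 1x1 block whose diagonal condition is q <=
    max(p, z) if [b] is true and, by [flip], p <= max(q, z) otherwise. The coefficients of z have
    modulus 0, the tropical unit. *)
Definition lift_entry (a b : index) : 'I_(n + d) -> ST :=
  match a, b with
  | Some (inl i), Some (inl j) =>
      if i == j then concat (fun k => Q k i i) (@zero_form R d)
      else concat (@zero_form R n) (var (edge i j) (STneg 0%R))
  | Some (inr t), Some (inr t') =>
      if t == t' then
        concat (fun k => let q := Q k t.2.1 t.2.2 in if t.1 then q else flip q)
               (var t.2 (STpos 0%R))
      else concat (@zero_form R n) (@zero_form R d)
  | _, _ => concat (@zero_form R n) (@zero_form R d)
  end.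

(** Off the diagonal no original variable occurs, and an auxiliary one occurs only with negative
    sign; hence the Metzler property, whatever the signs in [Q]. *)
Lemma lift_entry_off a b : a != b ->
  lift_entry a b = concat (@zero_form R n)
    (if (a, b) is (Some (inl i), Some (inl j)) then var (edge i j) (STneg 0%R)
     else @zero_form R d).
Proof.
by case: a b => [[i|t]|] [[j|t']|] //= ab; rewrite ifN.
Qed.

Definition metzler_lift (k : 'I_(n + d)) : 'M[ST]_#|{: index}| :=
  \matrix_(a, b) lift_entry (enum_val a) (enum_val b) k.

Lemma metzler_lift_sym k : sym_mx (metzler_lift k).
Proof.
apply/matrixP => a b; rewrite !mxE.
case: (enum_val a) (enum_val b) => [[i|t]|] [[j|t']|] //=.
- by rewrite eq_sym edgeC; case: eqP => [->|].
- by rewrite eq_sym; case: eqP => [->|].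
Qed.

Lemma metzler_lift_metzler k : tropical_metzler (metzler_lift k).
Proof.
move=> a b; rewrite -(inj_eq enum_val_inj) !mxE => ab.
rewrite lift_entry_off // /concat; case: (split k) => e; first by right.
case: (enum_val a) (enum_val b) {ab} => [[i|t]|] [[j|t']|]; try by right.
by rewrite /var; case: ifP; [left | right].
Qed.

Lemma Qpos_lift w (a b : index) :
  Qpos metzler_lift w (enum_rank a) (enum_rank b) =
  form (@is_STpos R) (lift_entry a b) w.
Proof. by apply: eq_big => k; rewrite !mxE !enum_rankK. Qed.

Lemma Qneg_lift w (a b : index) :
  Qneg metzler_lift w (enum_rank a) (enum_rank b) =
  form (@is_STneg R) (lift_entry a b) w.
Proof. by apply: eq_big => k; rewrite !mxE !enum_rankK. Qed.

(** The three families come from the diagonal of the [inl] block, its minors, and the 1x1 blocks, in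
    this order. *)
Lemma metzler_liftP x (y : 'rV[tropical R]_d) :
  let z (t : pair) : \bar R := val (y ord0 (enum_rank t)) in
  spectrahedron metzler_lift (row_mx x y) <->
  [/\ forall i, Qneg Q x i i <= Qpos Q x i i,
      forall i j : 'I_m, (i < j)%N -> 2%:E * z (i, j) <= Qpos Q x i i + Qpos Q x j j &
      forall i j, Qpos Q x i j <= maxe (Qneg Q x i j) (z (i, j)) /\
                  Qneg Q x i j <= maxe (Qpos Q x i j) (z (i, j))].
Proof.
move=> z; set w := row_mx x y.
have maxN (e : \bar R) : maxe e -oo = e by rewrite maxC maxNye.
have diagE s i : s STninfty = false ->
    form s (lift_entry (Some (inl i)) (Some (inl i))) w =
    form s (fun k => Q k i i) x.
  by move=> s0; rewrite /= eqxx form_concat form_zero// maxN.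
have offE i j : i != j ->
    form (@is_STneg R) (lift_entry (Some (inl i)) (Some (inl j))) w =
    z (edge i j).
  by move=> ij; rewrite /= (negPf ij) form_concat form_zero// form_var//= maxNye add0e.
have zeroE s : s STninfty = false ->
    form s (concat (@zero_form R n) (@zero_form R d)) w = -oo.
  by move=> s0; rewrite form_concat !form_zero// maxN.
have slackposE b t :
    form (@is_STpos R) (lift_entry (Some (inr (b, t))) (Some (inr (b, t)))) w =
    maxe (if b then Qpos Q x t.1 t.2 else Qneg Q x t.1 t.2) (z t).
  rewrite /= eqxx form_concat form_var//= add0e; congr maxe.
  by case: b; rewrite //= form_flip_pos.
have slacknegE b t :
    form (@is_STneg R) (lift_entry (Some (inr (b, t))) (Some (inr (b, t)))) w =
    if b then Qneg Q x t.1 t.2 else Qpos Q x t.1 t.2.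
  rewrite /= eqxx form_concat form_var//= maxN.
  by case: b; rewrite //= form_flip_neg.
rewrite (metzler_spectrahedronP _ metzler_lift_sym metzler_lift_metzler).
split=> [[diag off]|[diag off slack]].
  split=> [i|i j ij|i j].
  - by have := diag (enum_rank (Some (inl i))); rewrite Qpos_lift Qneg_lift !diagE.
  - have ij' : i != j by rewrite -(inj_eq val_inj) ltn_eqF.
    have := off (enum_rank (Some (inl i))) (enum_rank (Some (inl j))).
    rewrite (inj_eq enum_rank_inj) => /(_ ij').
    by rewrite !Qpos_lift Qneg_lift !diagE// offE// /edge ij.
  - have H b := diag (enum_rank (Some (inr (b, (i, j))))).
    move: (H false) (H true).
    by rewrite !Qpos_lift !Qneg_lift !slackposE !slacknegE.
split=> [a|a b].
  rewrite -(enum_valK a) Qpos_lift Qneg_lift.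
  case: (enum_val a) => [[i|[b [i j]]]|].
  - rewrite !diagE//; exact: diag.
  - by rewrite slackposE slacknegE; case: b; case: (slack i j).
  - by rewrite /= !zeroE.
rewrite -(inj_eq enum_val_inj) -{2 3 4}(enum_valK a) -{2 3 4}(enum_valK b).
rewrite !Qpos_lift Qneg_lift.
have trivial e : 2%:E * -oo <= e :> \bar R by rewrite gt0_muleNy ?lte_fin// leNye.
(* Outside the [inl] block every off-diagonal form is -oo, so its minor imposes nothing. *)
case: (enum_val a) (enum_val b) => [[i|t]|] [[j|t']|] ab;
  try by rewrite [X in _ * form _ X _]lift_entry_off// zeroE// trivial.
have {}ab : i != j by apply: contraNneq ab => ->.
rewrite offE// !diagE//.
case: (ltngtP i j) => [ij|ji|/val_inj e].
- by rewrite /edge ij; apply: off.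
- by rewrite edgeC addeC /edge ji; apply: off.
- by rewrite e eqxx in ab.
Qed.

Lemma metzler_lift_projection :
  spectrahedron Q =
    [set x | exists y, spectrahedron metzler_lift (row_mx x y)].
Proof.
apply/seteqP; split=> x /=.
  move=> [diag off].
  pose p (t : pair) := Qpos Q x t.1 t.2; pose q (t : pair) := Qneg Q x t.1 t.2.
  pose z t := if p t == q t then -oo else maxe (p t) (q t).
  (* The witness must have its coordinates in T, which excludes +oo. *)
  have z_fin t : z t != +oo.
    rewrite /z; case: ifP => // _.
    by rewrite /Order.max; case: ifP; rewrite ?Qpos_neq_pinfty ?Qneg_neq_pinfty.
  exists (\row_e exist _ (z (enum_val e)) (z_fin (enum_val e)))%R.
  apply/metzler_liftP; split=> // i j; rewrite mxE /= enum_rankK /z /p /q /=.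
    (* If p = q, the left side is -oo; if not, only the first alternative of [off] remains, and it
       is the goal. *)
    by move=> /off; case: eqP => [_ _|ne [//|//]]; rewrite gt0_muleNy ?lte_fin// leNye.
  by case: eqP => [->|_]; rewrite !le_max !lexx ?orbT.
move=> [y /metzler_liftP [diag off slack]]; split=> // i j /off zle.
by have [] := slack i j; apply: slack_sound zle.
Qed.

End MetzlerLift.

Theorem proposition6 (R : realType) (m n : nat)
    (Q : 'I_n -> 'M[signed_tropical R]_m)
    (symQ : forall k : 'I_n, sym_mx (Q k)) :
  exists (d p : nat) (P : 'I_(n + d) -> 'M[signed_tropical R]_p),
    [/\ (1 <= p)%N,
        (forall k : 'I_(n + d), sym_mx (P k)),
        (forall k : 'I_(n + d), tropical_metzler (P k)) &
        spectrahedron Q =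
          [set x : 'rV[tropical R]_n |
             exists y : 'rV[tropical R]_d, spectrahedron P (row_mx x y)]].
Proof.
(* The lift has d = m^2 auxiliary variables and size p = 1 + m + 2 m^2. *)
eexists; eexists; exists (metzler_lift Q); split.
- by rewrite card_option.
- exact: metzler_lift_sym.
- exact: metzler_lift_metzler.
- exact: metzler_lift_projection.
Qed.
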